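(* Let $\mathbf{R}=\{R_i,t_i\}_{i\ge0}$ be a preperfectoid tower arising from a pair $(R,I_0)$, with small tilts $R_i^{s.\flat}$ and ideal $I_0^{s.\flat}\subset R_0^{s.\flat}$. Then for every $i\ge0$, the isomorphism $R_i^{s.\flat}/I_0^{s.\flat}R_i^{s.\flat}\xrightarrow{\cong}R_i/I_0R_i$ induced by the $0$-th projection $R_i^{s.\flat}\to R_i/I_0R_i$ extends to an isomorphism of graded rings $$\mathrm{gr}_{I_0^{s.\flat}}^\bullet(R_i^{s.\flat})\xrightarrow{\ \cong\ }\mathrm{gr}_{I_0}^\bullet(R_i)$$ (that is, there is an isomorphism of graded rings whose degree-$0$ part is the given isomorphism).
   Context: All rings are commutative and unital. $p$ is a fixed prime. A pair $(A,I)$ is a ring $A$ with an ideal $I$. A tower of rings is an inductive system of rings $\mathbf{R}=\{R_i,t_i\colon R_i\to R_{i+1}\}_{i\ge0}$ indexed by $\mathbb{N}$. For a ring $A$, an ideal $I\subset A$ and an $A$-module $M$, an element $x\in M$ is $I$-torsion if for every $a\in I$ there is $n>0$ with $a^nx=0$; $M_{I\text{-tor}}$ is the submodule of $I$-torsion elements. Let $\varphi_{I,M}\colon M_{I\text{-tor}}\hookrightarrow M\twoheadrightarrow M/IM$ be the natural composite. For an $A$-algebra $B$, $\mathrm{gr}_I^\bullet(B)=\bigoplus_{n\ge0}I^nB/I^{n+1}B$, a graded ring. $\varphi$ denotes the absolute Frobenius $x\mapsto x^p$ of an $\mathbb{F}_p$-algebra. Let $(R,I_0)$ be a pair and $\mathbf{R}=\{R_i,t_i\}_{i\ge0}$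 a tower of rings. $\mathbf{R}$ is a preperfectoid tower arising from $(R,I_0)$ if: (a) $R_0=R$ and $p\in I_0$. (b) For every $i\ge0$, the ring homomorphism $\overline{t_i}\colon R_i/I_0R_i\to R_{i+1}/I_0R_{i+1}$ induced by $t_i$ is injective. (c) For every $i\ge0$, $\mathrm{Im}(\varphi_{R_{i+1}/I_0R_{i+1}})\subset\mathrm{Im}(\overline{t_i})$. (Given (a)–(c), there is a unique ring homomorphism $F_i\colon R_{i+1}/I_0R_{i+1}\to R_i/I_0R_i$ with $\overline{t_i}\circ F_i=\varphi$, called the $i$-th Frobenius projection.) (d) For every $i\ge0$, $F_i$ is surjective. (f) $I_0$ is principal, and $R_1$ contains a principal ideal $I_1$ such that $I_1^p=I_0R_1$ and, for every $i\ge0$, $\mathrm{Ker}(F_i)=I_1(R_{i+1}/I_0R_{i+1})$. (g) For every $i\ge0$, $I_0(R_i)_{I_0\text{-tor}}=(0)$, and there exists a bijection $(F_i)_{\mathrm{tor}}\colon(R_{i+1})_{I_0\text{-tor}}\to(R_i)_{I_0\text{-tor}}$ such that $F_i\circ\varphi_{I_0,R_{i+1}}=\varphi_{I_0,R_i}\circ(F_i)_{\mathrm{tor}}$. Tilt: for $i\ge0$ the $i$-th small tilt is $$R_i^{s.\flat}=\varprojlim(\cdots\xrightarrow{F_{i+1}}R_{i+1}/I_0R_{i+1}\xrightarrow{F_i}R_i/I_0R_i),$$ whose $m$-th projection is the map to $R_{i+m}/I_0R_{i+m}$. The map $t_i^{s.\flat}\colon R_i^{s.\flat}\to R_{i+1}^{s.\flat}$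 is the unique ring homomorphism compatible, under the $m$-th projections, with $\overline{t_{i+m}}$ for all $m\ge0$; these maps make $\{R_i^{s.\flat}\}$ a tower and each $R_i^{s.\flat}$ an $R_0^{s.\flat}$-algebra. $I_0^{s.\flat}$ is the kernel of the $0$-th projection $R_0^{s.\flat}\to R_0/I_0$. It is known that for every $i\ge0$ the $0$-th projection induces an isomorphism $R_i^{s.\flat}/I_0^{s.\flat}R_i^{s.\flat}\cong R_i/I_0R_i$. *)

(* Defs.v *)
From HB Require Import structures.
From mathcomp Require Import all_boot all_algebra.
From mathcomp Require Import boolp classical_sets.

Set Implicit Arguments.
Unset Strict Implicit.
Unset Printing Implicit Defensive.

Import GRing.Theory.
Local Open Scope ring_scope.
Local Open Scope classical_set_scope.
Local Open Scope quotient_scope.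

(* All rings are [comPzRingType]s, so that the zero ring is allowed; ideals
   need not be proper and need not be decidable.  Hence [idealr] and the ring
   structure of [{ideal_quot _}], which require a nonzero ring and a proper
   ideal, do not apply; the underlying quotient group [Quotient.quot] does. *)

Identity Coercion set_to_fun : set >-> Funclass.

Record ideal (R : comPzRingType) := Ideal {
  ideal_set :> set R;
  ideal0 : ideal_set 0;
  idealD : forall x y, ideal_set x -> ideal_set y -> ideal_set (x + y);
  idealMl : forall a x, ideal_set x -> ideal_set (a * x)
}.

Section IdealTheory.
Variable R : comPzRingType.
Implicit Types (I K : ideal R) (S : set R).

Lemma idealMr I a x : I x -> I (x * a).
Proof. by rewrite mulrC; apply: idealMl. Qed.

Lemma idealN I x : I x -> I (- x).
Proof. by rewrite -mulN1r; apply: idealMl. Qed.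

Lemma idealB I x y : I x -> I y -> I (x - y).
Proof. by move=> Ix Iy; apply: idealD => //; apply: idealN. Qed.

Lemma ideal_sum I (T : Type) (r : seq T) (P : pred T) (F : T -> R) :
  (forall i, P i -> I (F i)) -> I (\sum_(i <- r | P i) F i).
Proof. by move=> H; apply: big_ind => //; [exact: ideal0 | exact: idealD]. Qed.

Lemma idealP I K : (I : set R) = K -> I = K.
Proof.
case: I K => [I I0 ID IM] [K K0 KD KM] /= E; rewrite E in I0 ID IM *.
by congr Ideal; exact: Prop_irrelevance.
Qed.

Definition ideal_full : ideal R.
Proof. by exists setT. Defined.

Definition ideal_gen S : ideal R.
Proof.
exists [set x | forall K, S `<=` K -> K x] => [K _|x y Hx Hy K SK|a x Hx K SK].
- exact: ideal0.
- by apply: idealD; [exact: Hx | exact: Hy].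
- by apply: idealMl; exact: Hx.
Defined.

Lemma sub_ideal_gen S : S `<=` ideal_gen S.
Proof. by move=> x Sx K; apply. Qed.

Lemma ideal_gen_min S K : S `<=` K -> ideal_gen S `<=` K.
Proof. by move=> SK x; apply. Qed.

Definition ideal_mul I K : ideal R :=
  ideal_gen [set z | exists x y, [/\ I x, K y & z = x * y]].

Definition ideal_exp I (n : nat) : ideal R := iterop n ideal_mul I ideal_full.

Definition is_principal I := exists f : R, I = ideal_gen [set f].

Definition ideal_colon K (y : R) : ideal R.
Proof.
exists [set x | K (x * y)] => [|u v|a u] /=.
- by rewrite mul0r; exact: ideal0.
- by rewrite mulrDl; exact: idealD.
- by rewrite -mulrA; exact: idealMl.
Defined.

Lemma ideal_gen_mul S S' K :
    (forall x y, S x -> S' y -> K (x * y)) ->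
  forall x y, ideal_gen S x -> ideal_gen S' y -> K (x * y).
Proof.
move=> H x y Sx S'y; apply: (Sx (ideal_colon K y)) => s Ss /=.
rewrite mulrC; apply: (S'y (ideal_colon K s)) => s' Ss' /=.
by rewrite mulrC; exact: H.
Qed.

Lemma ideal_expS_mul I n x y : I x -> ideal_exp I n y -> ideal_exp I n.+1 (x * y).
Proof.
case: n => [|n] Ix Iy; first exact: idealMr.
by apply: sub_ideal_gen; exists x, y.
Qed.

Lemma ideal_expD_mul I m n x y :
  ideal_exp I m x -> ideal_exp I n y -> ideal_exp I (m + n) (x * y).
Proof.
elim: m x => [|[|m] IHm] x Ix Iy; first exact: idealMl.
  by rewrite add1n; exact: (@ideal_expS_mul I n x y).
apply: (Ix (ideal_colon (ideal_exp I (m.+2 + n)) y)) => _ [u [v [Iu Iv ->]]].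
rewrite -[ideal_set _ _]/(ideal_exp I (m.+1 + n).+1 (u * v * y)) -mulrA.
by apply: ideal_expS_mul => //; exact: IHm.
Qed.

Lemma ideal_exp_subS I n : ideal_exp I n.+1 `<=` ideal_exp I n.
Proof.
case: n => [//|n]; apply: ideal_gen_min => _ [u [v [_ Iv ->]]].
exact: idealMl.
Qed.

Definition ideal_pred I : {pred R} := fun x => `[< I x >].

Lemma ideal_predP I x : reflect (I x) (x \in ideal_pred I).
Proof. exact: asboolP. Qed.

Fact ideal_pred_zmod I : zmod_closed (ideal_pred I).
Proof.
split=> [|x y /ideal_predP Ix /ideal_predP Iy]; apply/ideal_predP.
  exact: ideal0.
exact: idealB.
Qed.

HB.instance Definition _ I :=
  GRing.isZmodClosed.Build R (ideal_pred I) (ideal_pred_zmod I).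

Definition rquot I := Quotient.quot (ideal_pred I).

HB.instance Definition _ I := GRing.Zmodule.on (rquot I).

Section Quotient.
Variable I : ideal R.

Definition qpi (x : R) : rquot I := \pi_(Quotient.quot (ideal_pred I)) x.

Definition qrepr (x : rquot I) : R := repr x.

Lemma qreprK x : qpi (qrepr x) = x.
Proof. exact: reprK. Qed.

Lemma qpi_eqP x y : qpi x = qpi y <-> I (x - y).
Proof.
rewrite /qpi; split=> [/eqP|Ixy].
  by rewrite -Quotient.idealrBE => /ideal_predP.
by apply/eqP; rewrite -Quotient.idealrBE; apply/ideal_predP.
Qed.

Lemma qpi_is_zmod_morphism : zmod_morphism qpi.
Proof. by move=> x y; exact: (raddfB \pi_(Quotient.quot (ideal_pred I))). Qed.

HB.instance Definition _ :=
  GRing.isZmodMorphism.Build R (rquot I) qpi qpi_is_zmod_morphism.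

Lemma qpi_eq0P x : qpi x = 0 <-> I x.
Proof. by rewrite -(raddf0 qpi) qpi_eqP subr0. Qed.

Lemma qrepr_qpi x : I (qrepr (qpi x) - x).
Proof. by apply/qpi_eqP; rewrite qreprK. Qed.

Definition qone : rquot I := qpi 1.
Definition qmul (x y : rquot I) : rquot I := qpi (qrepr x * qrepr y).

Lemma qpiM x y : qpi (x * y) = qmul (qpi x) (qpi y).
Proof.
apply/qpi_eqP; set x' := qrepr _; set y' := qrepr _.
have -> : x * y - x' * y' = - ((x' - x) * y' + x * (y' - y)).
  by rewrite mulrBl mulrBr addrA addrNK opprB.
apply: idealN; apply: idealD; [apply: idealMr|apply: idealMl];
  exact: qrepr_qpi.
Qed.

Fact qmulA : associative qmul.
Proof.
by move=> x y z; rewrite -[x]qreprK -[y]qreprK -[z]qreprK -!qpiM mulrA.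
Qed.

Fact qmulC : commutative qmul.
Proof. by move=> x y; rewrite /qmul mulrC. Qed.

Fact qmul1 : left_id qone qmul.
Proof. by move=> x; rewrite -[x]qreprK -qpiM mul1r. Qed.

Fact qmulDl : left_distributive qmul +%R.
Proof.
move=> x y z; rewrite -[x]qreprK -[y]qreprK -[z]qreprK.
by rewrite -raddfD -!qpiM -raddfD mulrDl.
Qed.

HB.instance Definition _ :=
  GRing.Zmodule_isComPzRing.Build (rquot I) qmulA qmulC qmul1 qmulDl.

Fact qpi_is_monoid_morphism : monoid_morphism qpi.
Proof. by split=> // x y; rewrite qpiM. Qed.

HB.instance Definition _ :=
  GRing.isMonoidMorphism.Build R (rquot I) qpi qpi_is_monoid_morphism.

End Quotient.
End IdealTheory.

Arguments ideal_full R : clear implicits.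

Section Morphisms.
Variables (A B : comPzRingType) (f : {rmorphism A -> B}).

Definition ideal_ext (I : ideal A) : ideal B := ideal_gen (f @` I).

Definition ideal_ker : ideal A.
Proof.
exists [set x | f x = 0] => [|x y fx fy|a x fx] /=.
- exact: rmorph0.
- by rewrite rmorphD fx fy addr0.
- by rewrite rmorphM fx mulr0.
Defined.

Variables (I : ideal A) (fI : I `<=` ideal_ker).

Definition quot_lift of I `<=` ideal_ker := fun x : rquot I => f (qrepr x).

Lemma quot_lift_qpi x : quot_lift fI (qpi I x) = f x.
Proof.
by apply/eqP; rewrite -subr_eq0 -rmorphB; apply/eqP/fI; exact: qrepr_qpi.
Qed.

Fact quot_lift_is_zmod_morphism : zmod_morphism (quot_lift fI).
Proof.
move=> x y; rewrite -[x]qreprK -[y]qreprK -rmorphB !quot_lift_qpi.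
exact: rmorphB.
Qed.

Fact quot_lift_is_monoid_morphism : monoid_morphism (quot_lift fI).
Proof.
split=> [|x y]; first by rewrite -(rmorph1 (qpi I)) quot_lift_qpi rmorph1.
by rewrite -[x]qreprK -[y]qreprK -rmorphM !quot_lift_qpi rmorphM.
Qed.

HB.instance Definition _ := GRing.isZmodMorphism.Build _ _ (quot_lift fI)
  quot_lift_is_zmod_morphism.
HB.instance Definition _ := GRing.isMonoidMorphism.Build _ _ (quot_lift fI)
  quot_lift_is_monoid_morphism.

End Morphisms.

(* [B] is regarded as an [A]-algebra through [f]. *)
Section AssociatedGraded.
Variables (A B : comPzRingType) (f : {rmorphism A -> B}) (I : ideal A).

Definition gr_ideal (n : nat) : ideal B := ideal_ext f (ideal_exp I n).
Local Notation J := gr_ideal.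

Lemma gr_ideal0 x : J 0 x.
Proof.
rewrite -[x]mulr1; apply: idealMl; apply: sub_ideal_gen.
by exists 1 => //; exact: rmorph1.
Qed.

Lemma gr_ideal_subS n : J n.+1 `<=` J n.
Proof.
apply: ideal_gen_min => _ [x Ix <-]; apply: sub_ideal_gen; exists x => //.
exact: ideal_exp_subS.
Qed.

Lemma gr_idealM m n x y : J m x -> J n y -> J (m + n) (x * y).
Proof.
apply: ideal_gen_mul => _ _ [u Iu <-] [v Iv <-].
apply: sub_ideal_gen; exists (u * v); last exact: rmorphM.
exact: ideal_expD_mul.
Qed.

(* The summand I^n B / I^(n+1) B is taken as the image of I^n B in
   B / I^(n+1) B, and the direct sum inside the product over n. *)
Record gr := Gr {
  gr_comp :> forall n, rquot (J n.+1);
  gr_compP : forall n, exists2 b, J n b & gr_comp n = qpi (J n.+1) b;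
  gr_finP : exists N, forall n, (N <= n)%N -> gr_comp n = 0
}.

Lemma grP (x y : gr) : (forall n, x n = y n) -> x = y.
Proof.
case: x y => [x x1 x2] [y y1 y2] /= E.
have {}E : x = y by exact: functional_extensionality_dep.
by case: _ / E in y1 y2 *; congr Gr; exact: Prop_irrelevance.
Qed.

HB.instance Definition _ := gen_eqMixin gr.
HB.instance Definition _ := gen_choiceMixin gr.

Lemma gr_qrepr (x : gr) n : J n (qrepr (x n)).
Proof.
have [b Jb xb] := gr_compP x n.
rewrite -[qrepr _](addrNK b); apply: idealD => //; apply: gr_ideal_subS.
by rewrite xb; exact: qrepr_qpi.
Qed.

Definition gr_of (a : nat -> B) (aJ : forall n, J n (a n))
  (a_fin : exists N, forall n, (N <= n)%N -> a n = 0) : gr.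
Proof.
exists (fun n => qpi (J n.+1) (a n)) => [n|]; first by exists (a n).
by have [N aN] := a_fin; exists N => n /aN ->; rewrite rmorph0.
Defined.

Definition gr_zero : gr.
Proof.
exists (fun n => 0) => [n|]; last by exists 0%N.
by exists 0; [exact: ideal0 | rewrite rmorph0].
Defined.

Definition gr_opp (x : gr) : gr.
Proof.
exists (fun n => - x n) => [n|].
  exists (- qrepr (x n)); first exact/idealN/gr_qrepr.
  by rewrite rmorphN /= qreprK.
by have [N xN] := gr_finP x; exists N => n /xN ->; rewrite oppr0.
Defined.

Definition gr_add (x y : gr) : gr.
Proof.
exists (fun n => x n + y n) => [n|].
  exists (qrepr (x n) + qrepr (y n)); first by apply: idealD; exact: gr_qrepr.
  by rewrite rmorphD /= !qreprK.
have [[N xN] [M yM]] := (gr_finP x, gr_finP y).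
exists (maxn N M) => n; rewrite geq_max => /andP[/xN -> /yM ->].
exact: addr0.
Defined.

Fact gr_addA : associative gr_add.
Proof. by move=> x y z; apply: grP => n /=; rewrite addrA. Qed.
Fact gr_addC : commutative gr_add.
Proof. by move=> x y; apply: grP => n /=; rewrite addrC. Qed.
Fact gr_add0 : left_id gr_zero gr_add.
Proof. by move=> x; apply: grP => n /=; rewrite add0r. Qed.
Fact gr_addN : left_inverse gr_zero gr_opp gr_add.
Proof. by move=> x; apply: grP => n /=; rewrite addNr. Qed.

HB.instance Definition _ :=
  GRing.isZmodule.Build gr gr_addA gr_addC gr_add0 gr_addN.

Definition conv (a b : nat -> B) n : B := \sum_(i < n.+1) a i * b (n - i)%N.

Lemma convC a b n : conv a b n = conv b a n.
Proof.
rewrite /conv (reindex_inj rev_ord_inj) /=; apply: eq_bigr => i _.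
by rewrite subSS mulrC subKn // -ltnS.
Qed.

Lemma convA a b c n : conv a (conv b c) n = conv (conv a b) c n.
Proof.
rewrite /conv.
transitivity (\sum_(i < n.+1) \sum_(j < n.+1 | (i <= j)%N)
                a i * (b (j - i)%N * c (n - j)%N)).
  apply: eq_bigr => i _; rewrite mulr_sumr.
  rewrite -(big_mkord xpredT
    (fun k => a i * (b k * c (n - i - k)%N))).
  rewrite -(big_mkord (fun j => (i <= j)%N)
    (fun j => a i * (b (j - i)%N * c (n - j)%N))).
  have ile : (i <= n)%N by rewrite -ltnS.
  rewrite [RHS](big_cat_nat (n := i)) ?(leqW ile) //=.
  rewrite [X in X + _]big_nat_cond [X in X + _]big_pred0 ?add0r; last first.
    by move=> j; rewrite leq0n /= (leqNgt i) andbN.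
  rewrite -{4}[nat_of_ord i]add0n big_addn subSn // big_nat_cond.
  rewrite [RHS]big_nat_cond.
  apply: eq_big => [k|k _]; first by rewrite leq_addl !andbT.
  by rewrite addnK [(k + i)%N]addnC subnDA.
rewrite (exchange_big_dep xpredT) //=; apply: eq_bigr => j _.
rewrite mulr_suml.
rewrite -(big_mkord (fun i => (i <= j)%N)
    (fun i => a i * (b (j - i)%N * c (n - j)%N))).
rewrite -(big_mkord xpredT (fun i => a i * b (j - i)%N * c (n - j)%N)).
rewrite [RHS](big_nat_widen _ _ n.+1) //.
by apply: eq_big => // i _; rewrite mulrA.
Qed.

Lemma conv_gr_ideal a b : (forall n, J n (a n)) -> (forall n, J n (b n)) ->
  forall n, J n (conv a b n).
Proof.
move=> Ja Jb n; apply: ideal_sum => i _.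
have ile : (i <= n)%N by rewrite -ltnS.
by rewrite -{1}(subnKC ile); exact: gr_idealM.
Qed.

Definition gr_one : gr.
Proof.
apply: (@gr_of (fun n => (n == 0%N)%:R)) => [[|n]|]; first exact: gr_ideal0.
  exact: ideal0.
by exists 1%N => -[].
Defined.

(* The product of the classes of a in I^i B and b in I^j B is the class of
   a * b in I^(i+j) B; [gr_mul_rep] says that the choice of the
   representatives is immaterial. *)
Definition gr_mul (x y : gr) : gr.
Proof.
exists (fun n => qpi (J n.+1)
  (conv (fun i => qrepr (x i)) (fun j => qrepr (y j)) n)) => [n|].
  by eexists; last reflexivity; apply: conv_gr_ideal => m; exact: gr_qrepr.
have [[N xN] [M yM]] := (gr_finP x, gr_finP y).
have J0 n (z : rquot (J n)) : z = 0 -> J n (qrepr z).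
  by move=> z0; apply/qpi_eq0P; rewrite qreprK.
exists (N + M)%N => n NMn; apply/qpi_eq0P; apply: ideal_sum => i _.
have ile : (i <= n)%N by rewrite -ltnS.
have [Ni|iN] := leqP N i.
  rewrite -{1}(subnKC ile) -addSn; apply: gr_idealM; last exact: gr_qrepr.
  exact/J0/xN.
rewrite -{1}(subnKC ile) -addnS; apply: gr_idealM; first exact: gr_qrepr.
apply/J0/yM; rewrite leq_subRL //; apply: leq_trans NMn.
by rewrite leq_add2r ltnW.
Defined.

Lemma gr_mul_rep (x y : gr) (a b : nat -> B) n :
    (forall i, J i (a i)) -> (forall i, J i (b i)) ->
    (forall i, x i = qpi _ (a i)) -> (forall i, y i = qpi _ (b i)) ->
  gr_mul x y n = qpi _ (conv a b n).
Proof.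
move=> Ja Jb xa yb; apply/qpi_eqP; rewrite /conv -sumrB; apply: ideal_sum.
move=> i _; have ile : (i <= n)%N by rewrite -ltnS.
set j := (n - i)%N; have nE : n.+1 = (i + j).+1 by rewrite /j subnKC.
suff: J (i + j).+1 (qrepr (x i) * qrepr (y j) - a i * b j) by rewrite -nE.
rewrite xa yb; set a' := qrepr _; set b' := qrepr _.
have -> : a' * b' - a i * b j = (a' - a i) * b' + a i * (b' - b j).
  by rewrite mulrBl mulrBr addrA addrNK.
apply: idealD; last by rewrite -addnS; apply: gr_idealM => //; exact: qrepr_qpi.
rewrite -addSn; apply: gr_idealM; first exact: qrepr_qpi.
by rewrite /b' -yb; exact: gr_qrepr.
Qed.

Fact gr_mulC : commutative gr_mul.
Proof. by move=> x y; apply: grP => n /=; rewrite convC. Qed.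

Fact gr_mulA : associative gr_mul.
Proof.
move=> x y z; apply: grP => n.
pose r (t : gr) i := qrepr (t i).
have Jr t i : J i (r t i) by exact: gr_qrepr.
have rE (t : gr) i : t i = qpi _ (r t i) by rewrite qreprK.
rewrite (gr_mul_rep (a := r x) (b := conv (r y) (r z))) //; last first.
  exact: conv_gr_ideal.
rewrite (gr_mul_rep (a := conv (r x) (r y)) (b := r z)) ?convA //.
exact: conv_gr_ideal.
Qed.

Fact gr_mul1 : left_id gr_one gr_mul.
Proof.
move=> x; apply: grP => n.
rewrite (gr_mul_rep (a := fun n => (n == 0%N)%:R) (b := fun i => qrepr (x i))) //.
- rewrite /conv big_ord_recl subn0 mul1r big1 ?addr0 ?qreprK // => i _.
  by rewrite mul0r.
- by case=> [|i]; [exact: gr_ideal0 | exact: ideal0].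
- by move=> i; exact: gr_qrepr.
- by move=> i; rewrite qreprK.
Qed.

Fact gr_mulDl : left_distributive gr_mul +%R.
Proof.
move=> x y z; apply: grP => n.
pose r (t : gr) i := qrepr (t i).
have Jr t i : J i (r t i) by exact: gr_qrepr.
have rE (t : gr) i : t i = qpi _ (r t i) by rewrite qreprK.
rewrite (gr_mul_rep (a := fun i => r x i + r y i) (b := r z)) //.
- rewrite /= -rmorphD /conv -big_split /=; congr qpi.
  by apply: eq_bigr => i _; rewrite mulrDl.
- by move=> i; exact: idealD.
- by move=> i; rewrite rmorphD /= /r !qreprK.
Qed.

HB.instance Definition _ :=
  GRing.Zmodule_isComPzRing.Build gr gr_mulA gr_mulC gr_mul1 gr_mulDl.

Definition gr_homog (n : nat) (x : gr) := forall m, m != n -> x m = 0.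

End AssociatedGraded.

(* A bijective graded ring morphism maps each homogeneous component onto the
   corresponding one, so its inverse is graded too. *)
Definition is_graded_iso (A B A' B' : comPzRingType)
    (f : {rmorphism A -> B}) (I : ideal A)
    (f' : {rmorphism A' -> B'}) (I' : ideal A')
    (Phi : {rmorphism gr f I -> gr f' I'}) :=
  bijective Phi /\ (forall n x, gr_homog n x -> gr_homog n (Phi x)).

Record tower := Tower {
  tower_ring :> nat -> comPzRingType;
  tower_trans : forall i, {rmorphism tower_ring i -> tower_ring i.+1}
}.

Fixpoint tower_map (T : tower) (i : nat) : {rmorphism T 0%N -> T i} :=
  match i with
  | 0 => idfun
  | j.+1 => tower_trans T j \o tower_map T j
  end.

(* The tower R_1 -> R_2 -> ..., so that [tower_map (tower_shift T) i] is the
   composite R_1 -> R_(i+1). *)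
Definition tower_shift (T : tower) : tower :=
  @Tower (fun i => T i.+1) (fun i => tower_trans T i.+1).

Section Preperfectoid.
Variables (p : nat) (p_pr : prime p) (T : tower) (I0 : ideal (T 0%N)).

Definition level_ideal (i : nat) : ideal (T i) := ideal_ext (tower_map T i) I0.

Definition Rbar (i : nat) : comPzRingType := rquot (level_ideal i).

Definition Rpi (i : nat) : {rmorphism T i -> Rbar i} := qpi (level_ideal i).

Fact tbar_subproof i :
  level_ideal i `<=` ideal_ker (Rpi i.+1 \o tower_trans T i).
Proof.
apply: ideal_gen_min => _ [x Ix <-]; apply/qpi_eq0P; apply: sub_ideal_gen.
by exists x.
Qed.

Definition tbar (i : nat) : {rmorphism Rbar i -> Rbar i.+1} :=
  quot_lift (@tbar_subproof i).

(* The pair (R, I_0) the tower arises from is (T 0, I0).  These are the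
   conditions under which the Frobenius projections exist. *)
Record purely_inseparable : Prop := PurelyInseparable {
  pins_p : I0 p%:R;
  pins_inj : forall i, injective (tbar i);
  pins_frob : forall i (x : Rbar i.+1), exists y : Rbar i, tbar i y = x ^+ p
}.

Section Tilt.
Variable HT : purely_inseparable.

Lemma Rbar_p i : p%:R = 0 :> Rbar i.
Proof.
rewrite -(rmorph_nat (Rpi i)); apply/qpi_eq0P; apply: sub_ideal_gen.
by exists p%:R; [exact: pins_p | exact: rmorph_nat].
Qed.

Lemma Rbar_frobD i (x y : Rbar i) : (x + y) ^+ p = x ^+ p + y ^+ p.
Proof.
rewrite exprDn -(prednK (prime_gt0 p_pr)) big_ord_recl big_ord_recr /=.
rewrite bin0 binn subn0 subnn expr0 mulr1 mul1r !mulr1n big1 ?add0r //.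
move=> k _; rewrite -mulr_natl.
have /dvdnP[q ->] : (p %| 'C(p.-1.+1, bump 0 k))%N.
  rewrite prednK ?prime_gt0 // prime_dvd_bin //= /bump add1n.
  by have := ltn_ord k; rewrite -ltnS prednK ?prime_gt0.
by rewrite natrM Rbar_p mulr0 mul0r.
Qed.

(* The Frobenius projection F_i, i.e. the unique map such that
   tbar_i \o F_i is the Frobenius. *)
Definition frob_proj (i : nat) (x : Rbar i.+1) : Rbar i :=
  sval (cid (pins_frob HT x)).

Lemma frob_projP i (x : Rbar i.+1) : tbar i (frob_proj x) = x ^+ p.
Proof. exact: (svalP (cid (pins_frob HT x))). Qed.

Lemma frob_proj_tbar i (x : Rbar i) : frob_proj (tbar i x) = x ^+ p.
Proof. by apply: (pins_inj HT); rewrite frob_projP rmorphXn. Qed.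

Fact frob_proj_is_zmod_morphism i : zmod_morphism (@frob_proj i).
Proof.
have D x y : frob_proj (x + y) = frob_proj x + frob_proj y :> Rbar i.
  by apply: (pins_inj HT); rewrite rmorphD !frob_projP Rbar_frobD.
by move=> x y; apply/eqP; rewrite eq_sym subr_eq -D subrK.
Qed.

Fact frob_proj_is_monoid_morphism i : monoid_morphism (@frob_proj i).
Proof.
split=> [|x y]; apply: (pins_inj HT).
  by rewrite frob_projP rmorph1 expr1n.
by rewrite rmorphM !frob_projP exprMn.
Qed.

HB.instance Definition _ i := GRing.isZmodMorphism.Build _ _ (@frob_proj i)
  (@frob_proj_is_zmod_morphism i).
HB.instance Definition _ i := GRing.isMonoidMorphism.Build _ _ (@frob_proj i)
  (@frob_proj_is_monoid_morphism i).

Definition Fproj (i : nat) : {rmorphism Rbar i.+1 -> Rbar i} := @frob_proj i.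

(* The small tilt R_i^{s.flat}.  Coordinates are indexed by the level j >= i,
   so that the m-th projection is the coordinate of level j = i + m. *)
Record small_tilt (i : nat) := SmallTilt {
  tilt_val : forall j, (i <= j)%N -> Rbar j;
  tilt_valP : forall j (ij : (i <= j)%N),
    Fproj j (tilt_val (leqW ij)) = tilt_val ij
}.

Definition tilt_proj i j (ij : (i <= j)%N) (x : small_tilt i) : Rbar j :=
  tilt_val x ij.

Lemma small_tiltP i (x y : small_tilt i) :
  (forall j (ij : (i <= j)%N), tilt_val x ij = tilt_val y ij) -> x = y.
Proof.
case: x y => [x xP] [y yP] /= E.
have {}E : x = y.
  apply: functional_extensionality_dep => j.
  by apply: functional_extensionality_dep => ij; exact: E.
by case: _ / E in yP *; congr SmallTilt; exact: Prop_irrelevance.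
Qed.

Section TiltRing.
Variable i : nat.
Implicit Types x y z : small_tilt i.

HB.instance Definition _ := gen_eqMixin (small_tilt i).
HB.instance Definition _ := gen_choiceMixin (small_tilt i).

Definition tilt_zero : small_tilt i.
Proof. by exists (fun _ _ => 0) => j ij; exact: rmorph0. Defined.

Definition tilt_one : small_tilt i.
Proof. by exists (fun _ _ => 1) => j ij; exact: rmorph1. Defined.

Definition tilt_opp x : small_tilt i.
Proof.
by exists (fun j ij => - tilt_val x ij) => j ij; rewrite rmorphN tilt_valP.
Defined.

Definition tilt_add x y : small_tilt i.
Proof.
exists (fun j ij => tilt_val x ij + tilt_val y ij) => j ij.
by rewrite rmorphD !tilt_valP.
Defined.

Definition tilt_mul x y : small_tilt i.
Proof.
exists (fun j ij => tilt_val x ij * tilt_val y ij) => j ij.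
by rewrite rmorphM !tilt_valP.
Defined.

Fact tilt_addA : associative tilt_add.
Proof. by move=> x y z; apply: small_tiltP => j ij /=; rewrite addrA. Qed.
Fact tilt_addC : commutative tilt_add.
Proof. by move=> x y; apply: small_tiltP => j ij /=; rewrite addrC. Qed.
Fact tilt_add0 : left_id tilt_zero tilt_add.
Proof. by move=> x; apply: small_tiltP => j ij /=; rewrite add0r. Qed.
Fact tilt_addN : left_inverse tilt_zero tilt_opp tilt_add.
Proof. by move=> x; apply: small_tiltP => j ij /=; rewrite addNr. Qed.

HB.instance Definition _ := GRing.isZmodule.Build (small_tilt i)
  tilt_addA tilt_addC tilt_add0 tilt_addN.

Fact tilt_mulA : associative tilt_mul.
Proof. by move=> x y z; apply: small_tiltP => j ij /=; rewrite mulrA. Qed.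
Fact tilt_mulC : commutative tilt_mul.
Proof. by move=> x y; apply: small_tiltP => j ij /=; rewrite mulrC. Qed.
Fact tilt_mul1 : left_id tilt_one tilt_mul.
Proof. by move=> x; apply: small_tiltP => j ij /=; rewrite mul1r. Qed.
Fact tilt_mulDl : left_distributive tilt_mul +%R.
Proof. by move=> x y z; apply: small_tiltP => j ij /=; rewrite mulrDl. Qed.

HB.instance Definition _ := GRing.Zmodule_isComPzRing.Build (small_tilt i)
  tilt_mulA tilt_mulC tilt_mul1 tilt_mulDl.

Fact tilt_proj_is_zmod_morphism j (ij : (i <= j)%N) :
  zmod_morphism (tilt_proj ij).
Proof. by []. Qed.

Fact tilt_proj_is_monoid_morphism j (ij : (i <= j)%N) :
  monoid_morphism (tilt_proj ij).
Proof. by []. Qed.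

HB.instance Definition _ j (ij : (i <= j)%N) :=
  GRing.isZmodMorphism.Build _ _ (tilt_proj ij)
    (tilt_proj_is_zmod_morphism ij).
HB.instance Definition _ j (ij : (i <= j)%N) :=
  GRing.isMonoidMorphism.Build _ _ (tilt_proj ij)
    (tilt_proj_is_monoid_morphism ij).

End TiltRing.

Section TiltMap.
Variable i : nat.
Implicit Types x y : small_tilt i.

Definition tilt_map_val x (j : nat) : (i.+1 <= j)%N -> Rbar j :=
  match j return (i.+1 <= j)%N -> Rbar j with
  | 0 => fun=> 0
  | k.+1 => fun ik : (i <= k)%N => tbar k (tilt_val x ik)
  end.

Definition tilt_map x : small_tilt i.+1.
Proof.
exists (@tilt_map_val x) => -[//|j] ij /=.
rewrite [LHS]frob_proj_tbar -(tilt_valP x (ij : (i <= j)%N)) [RHS]frob_projP.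
by congr (_ ^+ p); congr tilt_val; exact: bool_irrelevance.
Defined.

Fact tilt_map_is_zmod_morphism : zmod_morphism tilt_map.
Proof.
by move=> x y; apply: small_tiltP => -[//|j] ij; exact: (rmorphB (tbar j)).
Qed.

Fact tilt_map_is_monoid_morphism : monoid_morphism tilt_map.
Proof.
split=> [|x y]; apply: small_tiltP => -[//|j] ij; first exact: (rmorph1 (tbar j)).
exact: (rmorphM (tbar j)).
Qed.

HB.instance Definition _ := GRing.isZmodMorphism.Build _ _ tilt_map
  tilt_map_is_zmod_morphism.
HB.instance Definition _ := GRing.isMonoidMorphism.Build _ _ tilt_map
  tilt_map_is_monoid_morphism.

End TiltMap.

Definition tilt_tower : tower :=
  @Tower (fun i => small_tilt i) (fun i => @tilt_map i).

Lemma tilt_mapP i j (ij : (i <= j)%N) (x : small_tilt i) :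
  tilt_proj (ij : (i.+1 <= j.+1)%N) (tilt_map x) = tbar j (tilt_proj ij x).
Proof. by []. Qed.

Definition tilt_proj0 (i : nat) : {rmorphism tilt_tower i -> Rbar i} :=
  tilt_proj (leqnn i).

Lemma tilt_proj0_map i (x : small_tilt i) :
  tilt_proj0 i.+1 (tilt_map x) = tbar i (tilt_proj0 i x).
Proof.
rewrite -(tilt_mapP (leqnn i)); congr tilt_val; exact: bool_irrelevance.
Qed.

Definition tilt_ideal : ideal (tilt_tower 0%N) := ideal_ker (tilt_proj0 0).

Fact tilt_theta_subproof i :
  ideal_ext (tower_map tilt_tower i) tilt_ideal `<=` ideal_ker (tilt_proj0 i).
Proof.
apply: ideal_gen_min => _ [x x0 <-].
change (tilt_proj0 i (tower_map tilt_tower i x) = 0).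
elim: i => [|i IHi]; first exact: x0.
change (tilt_proj0 i.+1 (tilt_map (tower_map tilt_tower i x)) = 0).
by rewrite tilt_proj0_map IHi rmorph0.
Qed.

(* The map R_i^{s.flat} / I_0^{s.flat} R_i^{s.flat} -> R_i / I_0 R_i induced
   by the 0-th projection. *)
Definition tilt_theta (i : nat) :
    {rmorphism rquot (ideal_ext (tower_map tilt_tower i) tilt_ideal) -> Rbar i} :=
  quot_lift (@tilt_theta_subproof i).

End Tilt.

Definition I0_torsion (i : nat) (x : T i) :=
  forall a, I0 a -> exists2 n, (0 < n)%N & tower_map T i a ^+ n * x = 0.

(* [ppf_torsion0] says that the submodule I_0 (R_i)_tor, generated by the
   products below, is zero.  The bijections in [ppf_torsion] are bare maps of
   sets. *)
Record preperfectoid : Prop := Preperfectoid {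
  ppf_insep :> purely_inseparable;
  ppf_surj : forall i (y : Rbar i), exists x, Fproj ppf_insep i x = y;
  ppf_principal : is_principal I0;
  ppf_pillar : exists I1 : ideal (T 1%N),
    [/\ is_principal I1,
        ideal_exp I1 p = level_ideal 1 &
        forall i, ideal_ker (Fproj ppf_insep i) =
          ideal_ext (Rpi i.+1 \o tower_map (tower_shift T) i) I1];
  ppf_torsion0 : forall i (a : T 0%N) (x : T i),
    I0 a -> I0_torsion x -> tower_map T i a * x = 0;
  ppf_torsion : forall i,
    exists Ftor : {x : T i.+1 | I0_torsion x} -> {x : T i | I0_torsion x},
      bijective Ftor /\
      forall x, Fproj ppf_insep i (Rpi i.+1 (sval x)) = Rpi i (sval (Ftor x))
}.

End Preperfectoid.

(* Main.v *)
(* If multiplication by g on B has bounded torsion killed by g, then gr_g(B) is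
   the polynomial ring over B/g modulo (M T), with M the image of Ann(g) in B/g.
   So it suffices to compare M for R_i and for its small tilt.  The ideal
   I_0^{s.flat} is generated by a system w of F-compatible lifts of the pillar
   f1, and F maps the annihilator of a component of w into the image of the
   I_0-torsion of the tower.  As F is bijective on those images, the w-torsion
   of the tilt is their inverse limit, which is killed by w and projects
   bijectively onto M. *)
Require Import Defs.
From HB Require Import structures.
From mathcomp Require Import all_boot all_algebra.
From mathcomp Require Import boolp classical_sets.
From mathcomp Require Import ring.

Set Implicit Arguments.
Unset Strict Implicit.
Unset Printing Implicit Defensive.

Import GRing.Theory.
Local Open Scope ring_scope.

(** * Principal ideals, their powers and extensions *)

Definition principal_ideal (R : comPzRingType) (a : R) : ideal R.
Proof.
exists [set x | exists b, x = a * b]%classic => [|y z [b ->] [c ->]|c y [b ->]].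
- by exists 0; rewrite mulr0.
- by exists (b + c); rewrite mulrDr.
- by exists (c * b); rewrite mulrCA.
Defined.

Lemma ideal_gen1P (R : comPzRingType) (a x : R) :
  ideal_gen [set a]%classic x <-> exists b, x = a * b.
Proof.
split=> [|[b ->]]; last by apply: Defs.idealMr; exact: sub_ideal_gen.
move/(_ (principal_ideal a)); apply.
by move=> _ ->; exists 1; rewrite mulr1.
Qed.

Lemma ideal_exp_gen1 (R : comPzRingType) (a : R) n :
  ideal_exp (ideal_gen [set a]%classic) n = ideal_gen [set a ^+ n]%classic.
Proof.
elim: n => [|[|n] IHn] //.
  apply: idealP; apply/seteqP; split=> x //= _.
  by apply/ideal_gen1P; exists x; rewrite mul1r.
rewrite -[LHS]/(ideal_mul _ (ideal_exp _ n.+1)) IHn.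
apply: idealP; apply/seteqP; split.
  apply: ideal_gen_min => _ [y [z [/ideal_gen1P[b ->] /ideal_gen1P[c ->] ->]]].
  by apply/ideal_gen1P; exists (b * c); rewrite mulrACA -exprS.
apply: ideal_gen_min => _ ->; apply: sub_ideal_gen; exists a, (a ^+ n.+1).
by split; [exact: sub_ideal_gen | exact: sub_ideal_gen | rewrite -exprS].
Qed.

Lemma ideal_ext_gen1 (A B : comPzRingType) (f : {rmorphism A -> B}) a :
  ideal_ext f (ideal_gen [set a]%classic) = ideal_gen [set f a]%classic.
Proof.
apply: idealP; apply/seteqP; split.
  apply: ideal_gen_min => _ [_ /ideal_gen1P[b ->] <-].
  by apply/ideal_gen1P; exists (f b); rewrite rmorphM.
apply: ideal_gen_min => _ ->; apply: sub_ideal_gen.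
by exists a => //; exact: sub_ideal_gen.
Qed.

Lemma gr_ideal_gen1P (A B : comPzRingType) (f : {rmorphism A -> B}) a n x :
  gr_ideal f (ideal_gen [set a]%classic) n x <-> exists b, x = f a ^+ n * b.
Proof.
by rewrite /gr_ideal ideal_exp_gen1 ideal_ext_gen1 rmorphXn ideal_gen1P.
Qed.

(** * Graded rings of principal ideals, compared over a common quotient *)

(* Multiplication by g^n identifies gr^n with C modulo the image of the
   annihilator of g^n, which for n > 0 is the annihilator of g. *)
Section GradedCorrespondence.
Variables (A B A' B' C : comPzRingType).
Variables (f : {rmorphism A -> B}) (I : ideal A) (g : B).
Variables (f' : {rmorphism A' -> B'}) (I' : ideal A') (g' : B').
Variables (al : {rmorphism B -> C}) (al' : {rmorphism B' -> C}).
Local Notation J := (gr_ideal f I).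
Local Notation J' := (gr_ideal f' I').

(** A relation, because the representatives [b] and [b'] are not canonical: the ring operations are
    checked on it first, and only then is it shown to be the graph of a map. *)
Definition gr_corr (x : gr f I) (y : gr f' I') := forall n, exists b b',
  [/\ al b = al' b', x n = qpi _ (g ^+ n * b) & y n = qpi _ (g' ^+ n * b')].

Hypotheses (JP : forall n x, J n x <-> exists b, x = g ^+ n * b)
  (J'P : forall n x, J' n x <-> exists b, x = g' ^+ n * b).

Lemma gr_corrD x y x' y' :
  gr_corr x x' -> gr_corr y y' -> gr_corr (x + y) (x' + y').
Proof.
move=> xx' yy' n; have [b [b' [bb' xb xb']]] := xx' n.
have [c [c' [cc' yc yc']]] := yy' n.
exists (b + c), (b' + c'); rewrite !rmorphD bb' cc' !mulrDr.
by split=> //; rewrite rmorphD /= -?xb -?yc -?xb' -?yc'.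
Qed.

Lemma gr_corrN x x' : gr_corr x x' -> gr_corr (- x) (- x').
Proof.
move=> xx' n; have [b [b' [bb' xb xb']]] := xx' n.
exists (- b), (- b'); rewrite !rmorphN bb' !mulrN.
by split=> //; rewrite rmorphN /= -?xb -?xb'.
Qed.

Lemma gr_corr1 : gr_corr 1 1.
Proof.
move=> n; exists (n == 0%N)%:R, (n == 0%N)%:R; rewrite !rmorph_nat.
by split=> //; case: n => [|n]; rewrite ?expr0 ?mul1r ?mulr0.
Qed.

Lemma conv_expM (R : comPzRingType) (h : R) (b c : nat -> R) n :
  conv (fun k => h ^+ k * b k) (fun k => h ^+ k * c k) n = h ^+ n * conv b c n.
Proof.
rewrite /conv mulr_sumr; apply: eq_bigr => k _.
by rewrite mulrACA -exprD subnKC // -ltnS.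
Qed.

Lemma gr_corrM x y x' y' :
  gr_corr x x' -> gr_corr y y' -> gr_corr (x * y) (x' * y').
Proof.
move=> /choice[b /choice[b' xb]] /choice[c /choice[c' yc]] n.
exists (conv b c n), (conv b' c' n); rewrite -!conv_expM; split.
- rewrite !rmorph_sum; apply: eq_bigr => k _; rewrite !rmorphM.
  by have [-> _ _] := xb k; have [-> _ _] := yc (n - k)%N.
- apply: gr_mul_rep => k; try by case: (xb k); case: (yc k).
    by apply/JP; exists (b k).
  by apply/JP; exists (c k).
- apply: gr_mul_rep => k; try by case: (xb k); case: (yc k).
    by apply/J'P; exists (b' k).
  by apply/J'P; exists (c' k).
Qed.

Hypothesis al'_surj : forall c, exists b', al' b' = c.
Hypothesis al_g : al g = 0.
Hypothesis al'_ker : forall b', al' b' = 0 -> exists c, b' = g' * c.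
Hypothesis g_torsion : forall n b, g ^+ n * b = 0 -> g * b = 0.
Hypothesis ann_sub : forall b, g * b = 0 ->
  exists b', g' * b' = 0 /\ al b = al' b'.

(** If g^n b = g^(n+1) e, then b - g e is killed by g^n and has the image of b in [C]. For n > 0,
    [ann_sub] matches it with some d' killed by g'; for n = 0 take d' = 0. Then b' - d' is a
    multiple of g'. *)
Lemma gr_corr_eq0 n b b' : al b = al' b' ->
  J n.+1 (g ^+ n * b) -> J' n.+1 (g' ^+ n * b').
Proof.
move=> bb' /JP[e ge]; apply/J'P.
have ge0 : g ^+ n * (b - g * e) = 0 by rewrite mulrBr ge exprSr -mulrA subrr.
have alE : al b = al (b - g * e) by rewrite rmorphB rmorphM al_g mul0r subr0.
have [d' [gd' dE]] : exists d', g' ^+ n * d' = 0 /\ al b = al' d'.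
  case: n {ge} ge0 => [|n] ge0.
    by exists 0; rewrite mulr0 rmorph0 alE -[X in al X]mul1r ge0 rmorph0.
  have [d' [gd' dd']] := ann_sub (g_torsion ge0).
  by exists d'; rewrite exprSr -mulrA gd' mulr0 alE.
have [e' Ee'] : exists e', b' - d' = g' * e'.
  by apply: al'_ker; rewrite rmorphB -bb' dE subrr.
by exists e'; rewrite exprSr -mulrA -Ee' mulrBr gd' subr0.
Qed.

Lemma gr_corr_comp0 x y n : gr_corr x y -> x n = 0 -> y n = 0.
Proof.
move=> xy; have [b [b' [bb' -> ->]]] := xy n.
by move=> /qpi_eq0P Jb; apply/qpi_eq0P; exact: gr_corr_eq0 Jb.
Qed.

Lemma gr_corr_fun x y z : gr_corr x y -> gr_corr x z -> y = z.
Proof.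
move=> xy /gr_corrN xz; apply: grP => n; apply/eqP; rewrite -subr_eq0.
by apply/eqP/(gr_corr_comp0 (gr_corrD xy xz)); rewrite subrr.
Qed.

Lemma gr_corr_total x : exists y, gr_corr x y.
Proof.
have /choice[b xb] n : exists b, x n = qpi _ (g ^+ n * b).
  by have [_ /JP[b ->] xn] := gr_compP x n; exists b.
have /choice[b' bb'] n := al'_surj (al (b n)).
pose y n : rquot (J' n.+1) := qpi _ (g' ^+ n * b' n).
have y1 n : exists2 c, J' n c & y n = qpi _ c.
  by exists (g' ^+ n * b' n) => //; apply/J'P; exists (b' n).
have y2 : exists N, forall n, (N <= n)%N -> y n = 0.
  have [N xN] := gr_finP x; exists N => n /xN.
  by rewrite xb => /qpi_eq0P Jb; apply/qpi_eq0P; exact: gr_corr_eq0 Jb.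
by exists (Gr y1 y2) => n; exists (b n), (b' n).
Qed.

End GradedCorrespondence.

Lemma gr_corr_sym (A B A' B' C : comPzRingType) (f : {rmorphism A -> B})
    (I : ideal A) (g : B) (f' : {rmorphism A' -> B'}) (I' : ideal A') (g' : B')
    (al : {rmorphism B -> C}) (al' : {rmorphism B' -> C})
    (x : gr f I) (y : gr f' I') :
  gr_corr g g' al al' x y -> gr_corr g' g al' al y x.
Proof. by move=> xy n; have [b [b' []]] := xy n; exists b', b. Qed.

(** The hypotheses are symmetric, so the correspondence is total and single-valued both ways. The
    two maps chosen from it are mutually inverse, and uniqueness makes them respect the ring
    operations. *)
Lemma gr_iso (A B A' B' C : comPzRingType) (f : {rmorphism A -> B})
    (I : ideal A) (g : B) (f' : {rmorphism A' -> B'}) (I' : ideal A') (g' : B')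
    (al : {rmorphism B -> C}) (al' : {rmorphism B' -> C}) :
    (forall n x, gr_ideal f I n x <-> exists b, x = g ^+ n * b) ->
    (forall n x, gr_ideal f' I' n x <-> exists b, x = g' ^+ n * b) ->
    (forall c, exists b, al b = c) -> (forall c, exists b, al' b = c) ->
    (forall b, al b = 0 <-> exists c, b = g * c) ->
    (forall b, al' b = 0 <-> exists c, b = g' * c) ->
    (forall n b, g ^+ n * b = 0 -> g * b = 0) ->
    (forall n b, g' ^+ n * b = 0 -> g' * b = 0) ->
    (forall b, g * b = 0 -> exists b', g' * b' = 0 /\ al b = al' b') ->
    (forall b', g' * b' = 0 -> exists b, g * b = 0 /\ al' b' = al b) ->
  exists Phi : {rmorphism gr f I -> gr f' I'},
    is_graded_iso Phi /\ forall x, gr_corr g g' al al' x (Phi x).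
Proof.
move=> JP J'P surj surj' ker ker' tor tor' ann ann'.
have alg : al g = 0 by apply/ker; exists 1; rewrite mulr1.
have alg' : al' g' = 0 by apply/ker'; exists 1; rewrite mulr1.
have kerW b := (ker b).1; have kerW' b := (ker' b).1.
have /choice[Phi PhiP] := gr_corr_total JP J'P surj' alg kerW' tor ann.
have /choice[Psi PsiP] := gr_corr_total J'P JP surj alg' kerW tor' ann'.
have inj x := gr_corr_fun JP J'P alg kerW' tor ann (x := x).
have inj' y := gr_corr_fun J'P JP alg' kerW tor' ann' (x := y).
have PhiB : zmod_morphism Phi.
  move=> x y; apply: inj (PhiP _) _.
  exact: gr_corrD (PhiP x) (gr_corrN (PhiP y)).
have PhiM : monoid_morphism Phi.
  split=> [|x y]; first exact: inj (PhiP _) (gr_corr1 _ _ _ _ _ _ _ _).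
  exact: inj (PhiP _) (gr_corrM JP J'P (PhiP x) (PhiP y)).
pose m1 := GRing.isZmodMorphism.Build _ _ Phi PhiB.
pose m2 := GRing.isMonoidMorphism.Build _ _ Phi PhiM.
pose PhiR : {rmorphism gr f I -> gr f' I'} := HB.pack Phi m1 m2.
exists PhiR; split; last exact: PhiP.
split=> [|n x xn m mn].
  exists Psi => x; first exact: inj' (PsiP _) (gr_corr_sym (PhiP _)).
  exact: inj (PhiP _) (gr_corr_sym (PsiP _)).
apply: gr_corr_comp0 (PhiP x) (xn m mn); eassumption.
Qed.

(** * A computation of annihilators modulo g *)

(* Modulo g the element h^K equals phi times a unit, so h^(K p) x is x times
   g up to a unit and torsion. *)
Lemma annihilator_mod (B : comPzRingType) (p K n : nat)
    (g phi h u v e x c : B) :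
    (1 < p)%N -> phi ^+ p = g * u -> g = phi ^+ p * v ->
    h ^+ K = phi + g * e -> (n <= K * p)%N -> h ^+ n * x = g * c ->
  exists m a b, g * m = 0 /\ x = m + h ^+ (K * p - n) * a + g * b.
Proof.
case: p => [|[|p]] // _ phip gphi hK nKp hnx.
(* From here on [p] is two less than the original exponent, so phi^2 q0 = g e. *)
pose q0 := phi ^+ p * v * e.
have hKE : h ^+ K = phi * (1 + phi * q0).
  by rewrite hK {1}gphi /q0 !exprS; ring.
pose s := (1 + phi * q0) ^+ p.+2.
have [q sq] : exists q, s = 1 + phi * q.
  have /eqP := subrX1 (1 + phi * q0) p.+2; rewrite subr_eq => /eqP sE.
  exists (q0 * \sum_(i < p.+2) (1 + phi * q0) ^+ i).
  by rewrite /s sE addrC [1 + _ - 1]addrC addKr mulrA.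
have hKp : h ^+ (K * p.+2) = g * (u * s).
  by rewrite exprM hKE exprMn phip mulrA.
(* Since a power of phi equals g u, phi q is nilpotent modulo g, and a finite geometric sum inverts
   s modulo g. *)
have [r sr] : exists r, r * s = 1 - g * (u * (- q) ^+ p.+2).
  have := subrX1 (- (phi * q)) p.+2; set S := \sum_(i < _) _ => SE.
  exists S; apply: oppr_inj; rewrite opprB mulrA -phip -exprMn mulrN SE sq.
  by ring.
have gk : g * (1 - u * v) = 0.
  by rewrite mulrBr mulr1 mulrA -phip -gphi subrr.
set d := (K * p.+2 - n)%N.
have gm : g * (u * s * x - h ^+ d * c) = 0.
  have hd : h ^+ d * (h ^+ n * x) = g * (u * s) * x.
    by rewrite mulrA -exprD subnK // hKp.
  by rewrite mulrBr mulrA -hd hnx mulrCA subrr.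
(* Multiplication by r v undoes multiplication by u s, up to a multiple of g and an element killed
   by g. *)
exists (r * s * x * (1 - u * v) + r * v * (u * s * x - h ^+ d * c)).
exists (r * v * c), (u * (- q) ^+ p.+2 * x); split.
  by rewrite mulrDr mulrCA gk mulr0 mulrCA gm mulr0 addr0.
have xE : x = r * s * x + g * (u * (- q) ^+ p.+2) * x by rewrite sr; ring.
by rewrite {1}xE; ring.
Qed.

(** Coordinates of a small tilt depend on the proof of i <= j, so induction over levels has to carry
    that proof. *)
Lemma leq_dep_ind (i : nat) (P : forall j, (i <= j)%N -> Prop) :
    P i (leqnn i) -> (forall j (ij : (i <= j)%N), P j ij -> P j.+1 (leqW ij)) ->
  forall j (ij : (i <= j)%N), P j ij.
Proof.
move=> P0 PS; elim=> [|j IHj] ij.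
  case: i P P0 PS ij => // P P0 _ ij.
  by rewrite (bool_irrelevance ij (leqnn _)).
have [E|ij'] := eqVneq i j.+1.
  by subst i; rewrite (bool_irrelevance ij (leqnn _)).
have {}ij' : (i <= j)%N by rewrite -ltnS ltn_neqAle ij' ij.
by rewrite (bool_irrelevance ij (leqW ij')); exact: PS.
Qed.

Section Tilting.
Variables (p : nat) (p_pr : prime p) (T : tower) (I0 : ideal (T 0%N)).
Variable HT : preperfectoid p_pr I0.
Local Notation F := (Fproj p_pr HT).
Local Notation small := (small_tilt p_pr HT).
Local Notation pr := (@tilt_proj p p_pr T I0 HT _ _).

(** * Elements of a small tilt as compatible sequences *)

Lemma tilt_projS i j (ij : (i <= j)%N) (ij' : (i <= j.+1)%N) (x : small i) :
  F j (pr ij' x) = pr ij x.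
Proof. by rewrite (bool_irrelevance ij' (leqW ij)); exact: tilt_valP. Qed.

(** Dependent choice: [P] records what makes the next lift possible. *)
Lemma small_tilt_extend i (P : forall j, Rbar I0 j -> Prop) c0 :
    P i c0 ->
    (forall j c, (i <= j)%N -> P j c -> exists c', P j.+1 c' /\ F j c' = c) ->
  exists z : small i,
    pr (leqnn i) z = c0 /\ forall j (ij : (i <= j)%N), P j (pr ij z).
Proof.
move=> Pc0 PS.
(* The transport [ecast] imposes the value [c0] at level i within a predicate on all levels; values
   below level i do not enter the tilt. *)
pose Q j c := P j c /\ forall E : i = j, c = ecast j (Rbar I0 j) E c0.
pose fix Z j : Rbar I0 j := match j with
  | 0 => xget 0 (Q 0%N)
  | k.+1 => xget 0 (fun c => Q k.+1 c /\ ((i <= k)%N -> F k c = Z k))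
  end.
have Zi : Q i (Z i) /\ forall j, (i <= j)%N -> Q j (Z j) ->
    Q j.+1 (Z j.+1) /\ F j (Z j.+1) = Z j.
  have Qi : Q i c0 by split=> // E; rewrite (eq_irrelevance E erefl).
  split.
    case: i c0 Pc0 PS @Q @Z Qi => [|i] c0 Pc0 PS Q Z Qi /=.
      by apply: xgetPex; exists c0.
    have [|//] := @xgetPex _ 0
      (fun c => Q i.+1 c /\ ((i.+1 <= i)%N -> F i c = Z i)).
    by exists c0; rewrite ltnn.
  move=> j ij [Pj _].
  have [c [Pc Fc]] := PS j _ ij Pj.
  have [|QZ FZ] := @xgetPex _ 0
    (fun c => Q j.+1 c /\ ((i <= j)%N -> F j c = Z j)).
    by exists c; do !split=> //; move=> E; rewrite E ltnn in ij.
  by split=> //; exact: FZ.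
have ZQ : forall j (ij : (i <= j)%N), Q j (Z j).
  apply: (@leq_dep_ind i (fun j _ => Q j (Z j))) => [|j ij]; first exact: Zi.1.
  by move/(Zi.2 j ij)/proj1.
have ZF j (ij : (i <= j)%N) : F j (Z j.+1) = Z j.
  by apply: (Zi.2 j ij _).2; exact: ZQ.
exists (@SmallTilt p p_pr T I0 HT i (fun j _ => Z j) ZF); split.
  by have [_ /(_ erefl)] := ZQ i (leqnn i).
by move=> j ij; have [] := ZQ j ij.
Qed.

(** * Torsion of the tower and its image modulo I_0 *)

Definition torsion_image j (c : Rbar I0 j) :=
  exists2 x, I0_torsion I0 x & Rpi I0 j x = c.

Variable f0 : T 0%N.
Hypothesis I0E : I0 = ideal_gen [set f0]%classic.
Local Notation g j := (tower_map T j f0).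

Lemma level_idealP j x : level_ideal I0 j x <-> exists b, x = g j * b.
Proof. by rewrite /level_ideal {1}I0E ideal_ext_gen1 ideal_gen1P. Qed.

Lemma Rpi_eq0P j x : Rpi I0 j x = 0 <-> exists b, x = g j * b.
Proof. by rewrite -level_idealP; exact: qpi_eq0P. Qed.

Lemma torsionP j x : I0_torsion I0 x <-> g j * x = 0.
Proof.
split=> [tx|gx a].
  by apply: (ppf_torsion0 HT _ tx); rewrite I0E; exact: sub_ideal_gen.
rewrite {1}I0E => /ideal_gen1P[b ->]; exists 1%N => //.
by rewrite expr1 rmorphM mulrAC gx mul0r.
Qed.

Lemma level_gen_torsion j n x : g j ^+ n * x = 0 -> g j * x = 0.
Proof.
move=> gx; apply/torsionP => a.
rewrite {1}I0E => /ideal_gen1P[b ->]; exists n.+1 => //.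
by rewrite rmorphM exprMn mulrAC (exprS (g j)) -(mulrA _ _ x) gx mulr0 mul0r.
Qed.

Lemma torsion_image0 j : torsion_image (0 : Rbar I0 j).
Proof. by exists 0; [apply/torsionP; rewrite mulr0 | rewrite rmorph0]. Qed.

Lemma torsion_imageD j (c d : Rbar I0 j) :
  torsion_image c -> torsion_image d -> torsion_image (c + d).
Proof.
move=> [x /torsionP gx <-] [y /torsionP gy <-]; exists (x + y).
  by apply/torsionP; rewrite mulrDr gx gy addr0.
by rewrite rmorphD.
Qed.

Lemma torsion_imageM j (c d : Rbar I0 j) :
  torsion_image d -> torsion_image (c * d).
Proof.
move=> [x /torsionP gx <-]; exists (qrepr c * x).
  by apply/torsionP; rewrite mulrCA gx mulr0.
by rewrite rmorphM; congr (_ * _); exact: qreprK.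
Qed.

(** If x = g b is torsion, then g^2 b = 0, and bounded torsion already gives g b = 0. *)
Lemma torsion_Rpi_inj j x : I0_torsion I0 x -> Rpi I0 j x = 0 -> x = 0.
Proof.
move=> /torsionP gx /Rpi_eq0P[b xb]; rewrite xb.
by apply: (@level_gen_torsion j 2); rewrite expr2 -mulrA -xb.
Qed.

Lemma torsion_image_frob j (c : Rbar I0 j.+1) :
  torsion_image c -> torsion_image (F j c).
Proof.
have [Ftor [_ FtorE]] := ppf_torsion HT j.
move=> [x tx <-]; exists (sval (Ftor (exist _ x tx))); last by rewrite -FtorE.
exact: svalP.
Qed.

Lemma torsion_image_frob_surj j (c : Rbar I0 j) :
  torsion_image c -> exists2 d, torsion_image d & F j d = c.
Proof.
have [Ftor [[G _ GK] FtorE]] := ppf_torsion HT j.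
move=> [x tx <-]; set y := G (exist _ x tx).
exists (Rpi I0 j.+1 (sval y)); first by exists (sval y) => //; exact: svalP.
by rewrite FtorE GK.
Qed.

(** [Ftor] is only a bijection of sets, so that it sends 0 to 0 needs an argument: modulo I_0 the
    value is F 0 = 0, and torsion embeds in the quotient. *)
Lemma torsion_image_frob_inj j (c : Rbar I0 j.+1) :
  torsion_image c -> F j c = 0 -> c = 0.
Proof.
have [Ftor [/bij_inj Finj FtorE]] := ppf_torsion HT j.
have t0 : I0_torsion I0 (0 : T j.+1) by apply/torsionP; rewrite mulr0.
have F0 (y : {x : T j.+1 | I0_torsion I0 x}) :
    F j (Rpi I0 j.+1 (sval y)) = 0 -> sval (Ftor y) = 0.
  by rewrite FtorE => /torsion_Rpi_inj; apply; exact: svalP.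
move=> [x tx <-] Fx0.
pose y : {x : T j.+1 | I0_torsion I0 x} := exist _ x tx.
pose y0 : {x : T j.+1 | I0_torsion I0 x} := exist _ 0 t0.
have Ey : sval (Ftor y) = 0 by exact: F0.
have Ey0 : sval (Ftor y0) = 0 by apply: F0; rewrite /= !rmorph0.
have /Finj/(congr1 sval) x0 : Ftor y = Ftor y0.
  case: (Ftor y) (Ftor y0) Ey Ey0 => a ta [b tb] /= a0 b0.
  by apply: eq_exist; rewrite a0 b0.
by rewrite [x]x0 rmorph0.
Qed.

(** * The pillar and its lift w to the tilt *)

Variable f1 : T 1%N.
Hypothesis f1p : ideal_exp (ideal_gen [set f1]%classic) p = level_ideal I0 1.
Hypothesis F_ker : forall j, ideal_ker (F j) =
  ideal_ext (Rpi I0 j.+1 \o tower_map (tower_shift T) j)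
    (ideal_gen [set f1]%classic).
Local Notation phi j := (tower_map (tower_shift T) j f1 : T j.+1).

Lemma tower_map_shift j :
  tower_map (tower_shift T) j (tower_map T 1 f0) = g j.+1.
Proof.
elim: j => [//|j IHj].
exact: (congr1 (tower_trans T j.+1) IHj).
Qed.

(** Generators of the same ideal divide each other but need not differ by a unit, so both cofactors
    are kept. *)
Lemma pillar_dvd j : exists u v,
  phi j ^+ p = g j.+1 * u /\ g j.+1 = phi j ^+ p * v.
Proof.
have E x : level_ideal I0 1 x <-> exists b, x = f1 ^+ p * b.
  by rewrite -f1p ideal_exp_gen1 ideal_gen1P.
have /level_idealP[u fu] : level_ideal I0 1 (f1 ^+ p).
  by apply/E; exists 1; rewrite mulr1.
have /E[v gv] : level_ideal I0 1 (g 1).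
  by apply/level_idealP; exists 1; rewrite mulr1.
exists (tower_map (tower_shift T) j u), (tower_map (tower_shift T) j v).
rewrite -tower_map_shift -rmorphXn; split.
  by rewrite -rmorphM -fu.
by rewrite -rmorphM -gv.
Qed.

Lemma F_eq0P j (c : Rbar I0 j.+1) :
  F j c = 0 <-> exists b, c = Rpi I0 j.+1 (phi j) * b.
Proof.
by rewrite -[F j c = 0]/(ideal_ker (F j) c) F_ker ideal_ext_gen1 ideal_gen1P.
Qed.

(** [f1] lies in the kernel of F_0, hence above 0; from level 1 on, surjectivity of the projections
    continues the sequence. *)
Lemma tilt_pillar_exists : exists w : small 0%N,
  pr (leqnn 0) w = 0 /\ pr (leq0n 1) w = Rpi I0 1 f1.
Proof.
pose P j : Rbar I0 j -> Prop := match j return Rbar I0 j -> Prop with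
  | 0 => fun c => c = 0
  | 1 => fun c => c = Rpi I0 1 f1
  | _ => fun=> True
  end.
have [//|[|j] c _ Pc|w [w0 wP]] := @small_tilt_extend 0 P 0.
- exists (Rpi I0 1 f1); split=> //; rewrite Pc; apply/F_eq0P.
  by exists 1; rewrite mulr1.
- by have [d Fd] := ppf_surj HT c; exists d.
- by exists w; split=> //; exact: (wP 1%N).
Qed.

(** * Components of w as p-power roots of the pillar *)

Variable w : small 0%N.
Hypotheses (w0 : pr (leqnn 0) w = 0) (w1 : pr (leq0n 1) w = Rpi I0 1 f1).
Local Notation e i := (tower_map (tilt_tower p_pr HT) i w : small i).

Lemma pr_gen_trans i j (ij : (i <= j)%N) (ij' : (i.+1 <= j.+1)%N) :
  pr ij' (e i.+1) = tbar I0 j (pr ij (e i)).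
Proof. by rewrite (bool_irrelevance ij ij'). Qed.

(** A p-th power at level j is [tbar] of the component one level down, which is how w is carried to
    the next tilt. *)
Lemma pr_gen_frob i j (ij : (i <= j)%N) (ij' : (i < j)%N) :
  pr ij (e i) ^+ p = pr ij' (e i.+1).
Proof.
case: j ij ij' => // j ij ij'.
rewrite (pr_gen_trans (ij' : (i <= j)%N)) -(tilt_projS (ij' : (i <= j)%N) ij).
by symmetry; exact: frob_projP.
Qed.

Lemma pr_gen_diag i (ii : (i <= i)%N) : pr ii (e i) = 0.
Proof.
elim: i ii => [|i IHi] ii; first by rewrite (bool_irrelevance ii (leqnn 0)).
by rewrite (pr_gen_trans (leqnn i)) IHi rmorph0.
Qed.

Lemma pr_gen_pillar i (ii : (i <= i.+1)%N) : pr ii (e i) = Rpi I0 i.+1 (phi i).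
Proof.
elim: i ii => [|i IHi] ii; first by rewrite (bool_irrelevance ii (leq0n 1)).
rewrite (pr_gen_trans (leqnSn i)) IHi; exact: quot_lift_qpi.
Qed.

Lemma pr_gen_exp k i j (ij : (i <= j)%N) (ij' : (k + i <= j)%N) :
  pr ij (e i) ^+ (p ^ k) = pr ij' (e (k + i)%N).
Proof.
elim: k ij' => [|k IHk] ij'; first by rewrite expr1 (bool_irrelevance ij ij').
by rewrite expnSr exprM (IHk (ltnW ij')); exact: pr_gen_frob.
Qed.

(** After j - i Frobenius powers one reaches the image of w in the j-th tilt, whose component at
    level j+1 is the pillar generator. *)
Lemma pr_gen_exp_pillar i j (ij : (i <= j)%N) (ij' : (i <= j.+1)%N) :
  pr ij' (e i) ^+ (p ^ (j - i)) = Rpi I0 j.+1 (phi j).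
Proof.
have kj : (j - i + i <= j.+1)%N by rewrite subnK.
rewrite (pr_gen_exp ij' kj).
move: (j - i + i)%N (subnK ij) kj => m mj kj; subst m; exact: pr_gen_pillar.
Qed.

Lemma pr_gen_nilp i j (ij : (i <= j)%N) : pr ij (e i) ^+ (p ^ (j - i)) = 0.
Proof.
have kj : (j - i + i <= j)%N by rewrite subnK.
rewrite (pr_gen_exp ij kj).
move: (j - i + i)%N (subnK ij) kj => m mj kj; subst m; exact: pr_gen_diag.
Qed.

(** * Torsion of the tilt *)

Lemma frob_annihilator i j n (ij : (i <= j)%N) (ij' : (i <= j.+1)%N)
    (c : Rbar I0 j.+1) :
  (n <= p ^ (j - i))%N -> pr ij' (e i) ^+ n * c = 0 -> torsion_image (F j c).
Proof.
move=> nK; set K := (p ^ (j - i))%N in nK.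
(* As p >= 2 and n <= K, the exponent K p - n is at least K, enough to kill the component of w at
   level j. *)
have KKp : (K + n <= K * p)%N.
  apply: leq_trans (_ : K * 2 <= _)%N.
    by rewrite muln2 -addnn leq_add2l.
  by rewrite leq_mul2l prime_gt1 ?orbT.
set h := qrepr (pr ij' (e i)).
have hE : Rpi I0 j.+1 h = pr ij' (e i) by exact: qreprK.
have xE : Rpi I0 j.+1 (qrepr c) = c by exact: qreprK.
set x := qrepr c in xE; rewrite -hE -xE -rmorphXn -rmorphM => /Rpi_eq0P[b hx].
have /Rpi_eq0P[d hK] : Rpi I0 j.+1 (h ^+ K - phi j) = 0.
  by rewrite rmorphB rmorphXn hE (pr_gen_exp_pillar ij) subrr.
have {}hK : h ^+ K = phi j + g j.+1 * d by rewrite -hK addrC subrK.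
have [u [v [phiu gv]]] := pillar_dvd j.
have nKp : (n <= K * p)%N by apply: leq_trans KKp; exact: leq_addl.
(* Modulo g this writes c as torsion plus a multiple of h^(K p - n), and F sends the class of h to
   the component of w at level j. *)
have [m [a [a' [gm ->]]]] := annihilator_mod (prime_gt1 p_pr) phiu gv hK nKp hx.
rewrite !rmorphD !rmorphM.
have -> : Rpi I0 j.+1 (g j.+1) = 0 by apply/Rpi_eq0P; exists 1; rewrite mulr1.
rewrite rmorph0 mul0r addr0 !rmorphXn hE (tilt_projS ij).
have -> : pr ij (e i) ^+ (K * p - n) = 0.
  rewrite -(@subnK K (K * p - n)) ?exprD ?pr_gen_nilp ?mulr0 //.
  by rewrite leq_subRL // addnC.
rewrite mul0r addr0; apply: torsion_image_frob.
by exists m => //; apply/torsionP.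
Qed.

(** At level i the component of w is 0. Above it the product lies in the torsion image, where F is
    injective, so vanishing propagates upwards. *)
Lemma pr_gen_torsion i j (ij : (i <= j)%N) (c : Rbar I0 j) :
  torsion_image c -> pr ij (e i) * c = 0.
Proof.
move: j ij c; apply: leq_dep_ind => [|j ij IHj] c tc.
  by rewrite pr_gen_diag mul0r.
apply: torsion_image_frob_inj; first exact: torsion_imageM.
by rewrite rmorphM (tilt_projS ij) IHj //; exact: torsion_image_frob.
Qed.

Lemma tilt_annihilator i n (y : small i) : e i ^+ n * y = 0 ->
  forall j (ij : (i <= j)%N), torsion_image (pr ij y).
Proof.
move=> ey j ij.
have down k (ik : (i <= k + j)%N) :
    torsion_image (pr ik y) -> torsion_image (pr ij y).
  elim: k ik => [|k IHk] ik; first by rewrite (bool_irrelevance ik ij).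
  have ik' : (i <= k + j)%N by exact: leq_trans ij (leq_addl _ _).
  by move/torsion_image_frob; rewrite (tilt_projS ik'); exact: IHk.
have ik : (i <= n + j)%N by exact: leq_trans ij (leq_addl _ _).
(* Climbing n levels makes the exponent n small enough for [frob_annihilator]; torsion images then
   descend along F. *)
apply: (down n ik); rewrite -(tilt_projS ik (leqW ik)).
apply: (@frob_annihilator i _ n ik (leqW ik)).
  apply: leq_trans (ltnW (ltn_expl n (prime_gt1 p_pr))) _.
  by rewrite leq_exp2l ?prime_gt1 // -addnBA // leq_addr.
by rewrite -rmorphXn -rmorphM ey rmorph0.
Qed.

(** F is surjective on torsion images, so c lifts through torsion, which w kills at every level. *)
Lemma tilt_torsion_lift i (c : Rbar I0 i) : torsion_image c ->
  exists z : small i, e i * z = 0 /\ pr (leqnn i) z = c.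
Proof.
move=> tc; have [//|j d _ td|z [zc tz]] := @small_tilt_extend i torsion_image c.
  by have [d' td' Fd'] := torsion_image_frob_surj td; exists d'.
exists z; split=> //; apply: small_tiltP => j ij.
exact: pr_gen_torsion (tz j ij).
Qed.

(** * Kernel of the 0-th projection *)

Lemma pr_gen_dvd i (x : small i) : pr (leqnn i) x = 0 ->
  forall j (ij : (i <= j)%N), exists y, pr ij x = pr ij (e i) * y.
Proof.
move=> x0; apply: leq_dep_ind => [|j ij [y xy]].
  by exists 0; rewrite mulr0.
have [y' Fy'] := ppf_surj HT y.
(* Lifting the quotient y leaves an error divisible by the pillar generator, a positive power of the
   component of w. *)
have /F_eq0P[b xb] : F j (pr (leqW ij) x - pr (leqW ij) (e i) * y') = 0.
  by rewrite rmorphB rmorphM !(tilt_projS ij) Fy' xy subrr.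
have [q qE] : exists q, (p ^ (j - i) = q.+1)%N.
  by exists (p ^ (j - i)).-1; rewrite prednK // expn_gt0 prime_gt0.
exists (y' + pr (leqW ij) (e i) ^+ q * b).
rewrite mulrDr mulrA -exprS -qE (pr_gen_exp_pillar ij) -xb.
by rewrite addrC subrK.
Qed.

(* The quotients at the finite levels are unique only up to annihilators, but
   those annihilators become torsion one level down, where they can be
   corrected: a Mittag-Leffler argument. *)
Lemma tilt_proj_eq0P i (x : small i) :
  pr (leqnn i) x = 0 <-> exists z, x = e i * z.
Proof.
split=> [x0|[z ->]]; last by rewrite rmorphM /= pr_gen_diag mul0r.
(* The value kept at level j is the image of a quotient at level j+1, since such images are
   determined up to torsion. *)
pose P j c := exists c', F j c' = c /\
  forall ij : (i <= j.+1)%N, pr ij x = pr ij (e i) * c'.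
have [y xy] := pr_gen_dvd x0 (leqnSn i).
have [|j c ij [c' [Fc' xc']]|z [_ zP]] := @small_tilt_extend i P (F i y).
- by exists y; split=> // ij; rewrite (bool_irrelevance ij (leqnSn i)).
- have ij1 := leqW ij; have ij2 := leqW ij1.
  have [y2 xy2] := pr_gen_dvd x0 ij2.
  (* [F j.+1 y2] and [c'] differ by an annihilator of w at level j+1, so their images under F differ
     by torsion, which lifts again. *)
  have [m tm Fm] : exists2 m, torsion_image m & F j m = F j (F j.+1 y2 - c').
    apply: torsion_image_frob_surj; apply: (@frob_annihilator i j 1 ij ij1).
      by rewrite expn_gt0 prime_gt0.
    by rewrite expr1 mulrBr -xc' -(tilt_projS ij1 ij2) -rmorphM -xy2
      (tilt_projS ij1 ij2) subrr.
  have [m' tm' Fm'] := torsion_image_frob_surj tm.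
  exists (F j.+1 y2 - m); split; last first.
    by rewrite rmorphB Fm rmorphB Fc' opprB addrC subrK.
  (* Since w kills the torsion m', the corrected y2 - m' is still a quotient. *)
  exists (y2 - m'); split; first by rewrite rmorphB Fm'.
  move=> ij2'; rewrite mulrBr (pr_gen_torsion _ tm') subr0.
  by rewrite (bool_irrelevance ij2' ij2).
- exists z; apply: small_tiltP => j ij.
  have [c' [Fc' xc']] := zP j ij.
  transitivity (pr ij (e i) * pr ij z) => //.
  by rewrite -Fc' -(tilt_projS ij (leqW ij)) -rmorphM -xc' tilt_projS.
Qed.

Lemma tilt_proj0_surj i (c : Rbar I0 i) :
  exists z : small i, pr (leqnn i) z = c.
Proof.
have [j d _ _|z [zc _]] := @small_tilt_extend i (fun _ _ => True) c I.
  by have [d' Fd'] := ppf_surj HT d; exists d'.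
by exists z.
Qed.

(** * The graded isomorphism for the tower *)

Lemma tilt_idealE : tilt_ideal p_pr HT = ideal_gen [set w]%classic.
Proof.
apply: idealP; apply/seteqP; split=> x.
  by move/(tilt_proj_eq0P (i := 0)) => xw; apply/ideal_gen1P.
by move/ideal_gen1P => xw; apply/(tilt_proj_eq0P (i := 0)).
Qed.

Lemma tilt_gr_iso i :
  exists Phi : {rmorphism gr (tower_map (tilt_tower p_pr HT) i) (tilt_ideal p_pr HT)
                          -> gr (tower_map T i) I0},
    is_graded_iso Phi /\
    forall x, Phi x 0%N = tilt_theta p_pr HT i (x 0%N).
Proof.
have [||||||||||Phi [iso PhiP]] := @gr_iso _ _ _ _ (Rbar I0 i)
    (tower_map (tilt_tower p_pr HT) i) (tilt_ideal p_pr HT) (e i)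
    (tower_map T i) I0 (g i) (tilt_proj0 p_pr HT i) (Rpi I0 i).
- by rewrite tilt_idealE; exact: gr_ideal_gen1P.
- by rewrite {1}I0E; exact: gr_ideal_gen1P.
- exact: tilt_proj0_surj.
- by move=> c; exists (qrepr c); exact: qreprK.
- exact: tilt_proj_eq0P.
- exact: Rpi_eq0P.
- move=> n y /tilt_annihilator ty; apply: small_tiltP => j ij.
  exact: pr_gen_torsion (ty j ij).
- exact: level_gen_torsion.
- move=> y ey; have := @tilt_annihilator i 1 y.
  rewrite expr1 => /(_ ey i (leqnn i))[b tb Eb].
  by exists b; split; [apply/torsionP | rewrite Eb].
- move=> b gb; have [|z [ez zb]] := @tilt_torsion_lift i (Rpi I0 i b).
    by exists b => //; apply/torsionP.
  by exists z.
(* In degree 0 the correspondence says that the representatives agree in R_i / I_0 R_i, which is the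
   compatibility with [tilt_theta]. *)
exists Phi; split=> // x; have [b [b' [bb' -> ->]]] := PhiP x 0%N.
by rewrite !mul1r -[RHS]/(quot_lift _ (qpi _ b)) quot_lift_qpi bb'.
Qed.

End Tilting.

Unset Implicit Arguments.

Theorem proposition3p4 (p : nat) (p_pr : prime p) (T : tower)
    (I0 : ideal (T 0%N)) (HT : preperfectoid p_pr I0) (i : nat) :
  exists Phi : {rmorphism gr (tower_map (tilt_tower p_pr HT) i) (tilt_ideal p_pr HT)
                          -> gr (tower_map T i) I0},
    is_graded_iso Phi /\
    forall x, Phi x 0%N = tilt_theta p_pr HT i (x 0%N).
Proof.
have [f0 I0E] := ppf_principal HT.
have [_ [[f1 ->] f1p F_ker]] := ppf_pillar HT.
have [w [w0 w1]] := tilt_pillar_exists F_ker.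
exact: (tilt_gr_iso I0E f1p F_ker w0 w1).
Qed.
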